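(* Let $E$ be a normalized symmetric Banach sequence space with order continuous norm or $E=\ell^\infty$, let $G$ be a group and let $\rho \colon G \to \mathrm{Aut}^+_s(E)$ be a positive representation with compact image. Then there exist a unique isometric positive representation $\pi \colon G \to S(\mathbb{N})$ and an $m \in (\ell^\infty)^{++}$ such that \[ \rho_s = m \pi_s m^{-1} \quad \text{for all } s \in G. \] The image of $\pi$ is compact. Conversely, any positive representation $\pi \colon G \to S(\mathbb{N})$ with compact image and any $m \in (\ell^\infty)^{++}$ define a positive representation $\rho$ with compact image by $\rho_s := m \pi_s m^{-1}$ for all $s \in G$. In this correspondence between $\rho$ and $\pi$ (when $G$ is a topological group), $\rho$ is strongly continuous if and only if $\pi$ is strongly continuous. Moreover, if $\rho^1 = m_1 \pi^1 m_1^{-1}$ and $\rho^2 = m_2 \pi^2 m_2^{-1}$ are two positive representations of $G$ in $E$ with compact image, where $\pi^1, \pi^2 \colon G \to S(\mathbb{N})$ are isometric positive representations with compact image and $m_1, m_2 \in (\ell^\infty)^{++}$, then $\rho^1$ and $\rho^2$ are order equivalent if and only if $\pi^1$ and $\pi^2$ are isometrically order equivalent.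
   Context: A normalized symmetric Banach sequence space is a Banach lattice $E$ of real sequences (indexed by $\mathbb{N}$), with the pointwise ordering and lattice operations, such that: if $x\in E$ and $y$ is a sequence with $|y|\le|x|$, then $y\in E$ and $\|y\|\le\|x\|$; permutations of sequences in $E$ remain in $E$ with the same norm; and the standard unit vectors $e_n$ ($n\in\mathbb{N}$) have norm $1$. $\mathrm{Aut}^+_s(E)$ is the group $\mathrm{Aut}^+(E)$ of lattice automorphisms of $E$ with the strong operator topology. $S(\mathbb{N})$ is the group of permutations of $\mathbb{N}$, identified with the group of permutation operators on $E$, $(\phi x)_n := x_{\phi^{-1}(n)}$, and it carries the strong operator topology as a subset of $\mathrm{Aut}^+_s(E)$; it equals the group of isometric lattice automorphisms of $E$. $(\ell^\infty)^{++}$ is the set of $m\in\ell^\infty$ for which there is a $\delta>0$ with $m_n\ge\delta$ for all $n$; such $m$ is identified with the operator of pointwise multiplication by $m$ on $E$. A positive representation of a group $G$ in $E$ is a group homomorphism $\rho\colon G \to \mathrm{Aut}^+(E)$, and $\rho_s := \rho(s)$; it is strongly continuous if it is continuous for the strong operator topology, and compactness of the image is with respect to that topology. The notation $\rho = m\pi m^{-1}$ means $\rho_s=m\pi_sm^{-1}$ for all $s \in G$. Two positive representations $\rho,\theta$ of $G$ in $E$ are order equivalent if there is a lattice automorphism $T$ of $E$ with $T\rho_s=\theta_sT$ for all $s\in G$; they are isometrically order equivalent if $T$ can be chosen to be an isometric lattice automorphism. *)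

(* Defs.v *)
From HB Require Import structures.
From mathcomp Require Import all_boot all_order all_algebra.
From mathcomp Require Import all_classical all_reals all_analysis.

Set Implicit Arguments.
Unset Strict Implicit.
Unset Printing Implicit Defensive.

Import Order.TTheory GRing.Theory Num.Theory.
Import numFieldNormedType.Exports.

Local Open Scope classical_set_scope.
Local Open Scope ring_scope.

(* A Banach space [E] of real sequences is a Banach space with an injective
   linear map [coord] to the sequences, through which its elements are
   identified with sequences.  Solidity makes [E] a Banach lattice for the
   pointwise order (see [joinE]). *)
HB.mixin Record isSymmetricSeqSpace (R : realType) E
    & CompleteNormedModule R E := {
  coord : E -> nat -> R ;
  coord_linear : forall (a : R) (x y : E) (n : nat),
    coord (a *: x + y) n = a * coord x n + coord y n ;
  coord_inj : injective coord ;
  coord_solid : forall (x : E) (y : nat -> R),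
    (forall n, `|y n| <= `|coord x n|) ->
    exists2 z : E, coord z = y & `|z| <= `|x| ;
  coord_perm : forall (s : nat -> nat) (x : E), bijective s ->
    exists2 z : E, coord z = coord x \o s & `|z| = `|x| ;
  coord_unit : forall k : nat,
    exists2 z : E, coord z = (fun n => (n == k)%:R) & `|z| = 1 }.

#[short(type="symmetricSeqSpaceType")]
HB.structure Definition SymmetricSeqSpace (R : realType) :=
  { E of isSymmetricSeqSpace R E & CompleteNormedModule R E }.

HB.mixin Record Group_isTopological G & Group G & Topological G := {
  mulg_continuous : continuous (fun p : G * G => (p.1 * p.2)%g) ;
  invg_continuous : continuous (fun s : G => (s^-1)%g) }.

#[short(type="topologicalGroupType")]
HB.structure Definition TopologicalGroup :=
  { G of Group_isTopological G & Group G & Topological G }.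

Section SequenceSpace.
Variables (R : realType) (E : symmetricSeqSpaceType R).
Implicit Types (x y z : E) (T : E -> E) (m : nat -> R).

(* The element of [E] with coordinates [u]; junk value 0 if [u] is not in [E]. *)
Definition of_seq (u : nat -> R) : E := xget 0 [set z | coord z = u].

Lemma of_seqK (u : nat -> R) : range (@coord R E) u -> coord (of_seq u) = u.
Proof.
move=> [x _ xu]; rewrite /of_seq.
by case: xgetP => [z _ //|/(_ x)]; rewrite /= xu.
Qed.

Lemma coordZ (a : R) x n : coord (a *: x) n = a * coord x n.
Proof.
have h0 : coord (0 : E) n = 0.
  have := @coord_linear R E 1 0 0 n; rewrite scaler0 addr0 mul1r => /eqP.
  by rewrite -subr_eq0 opprD addrA subrr sub0r oppr_eq0 => /eqP.
by have := @coord_linear R E a x 0 n; rewrite h0 !addr0.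
Qed.

Lemma coordD x y n : coord (x + y) n = coord x n + coord y n.
Proof. by have := @coord_linear R E 1 x y n; rewrite scale1r mul1r. Qed.

Definition pwle x y : Prop := forall n, coord x n <= coord y n.

Definition join x y : E := of_seq (fun n => Num.max (coord x n) (coord y n)).

Lemma joinE x y n : coord (join x y) n = Num.max (coord x n) (coord y n).
Proof.
rewrite /join of_seqK //.
have [u uE _] : exists2 u : E, coord u = (fun n => `|coord x n|) & `|u| <= `|x|.
  by apply: coord_solid => k; rewrite normr_id.
have [v vE _] : exists2 v : E, coord v = (fun n => `|coord y n|) & `|v| <= `|y|.
  by apply: coord_solid => k; rewrite normr_id.
have hb k : `|Num.max (coord x k) (coord y k)| <= `|coord (u + v) k|.
  rewrite coordD uE vE [leRHS]ger0_norm ?addr_ge0//.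
  by case: (leP (coord x k) (coord y k)) => _; rewrite ?lerDl ?lerDr.
have [z zE _] :=
  @coord_solid R E _ (fun k => Num.max (coord x k) (coord y k)) hb.
by exists z.
Qed.

Definition lattice_automorphism T : Prop :=
  [/\ linear T, bijective T & forall x y, T (join x y) = join (T x) (T y)].

Definition isometric T : Prop := forall x, `|T x| = `|x|.

(* [T] is the operator (T x)_n = x_(phi^-1(n)) of a permutation [phi]. *)
Definition permutation_operator T : Prop :=
  exists phi psi : nat -> nat,
    [/\ cancel phi psi, cancel psi phi
      & forall x n, coord (T x) n = coord x (psi n)].

Definition linfty_pp m : Prop :=
  bounded_fun m /\ exists2 delta : R, 0 < delta & forall n, delta <= m n.

Definition mult_op m : E -> E := fun x => of_seq (fun n => m n * coord x n).

Lemma mult_opE m x n : bounded_fun m -> coord (mult_op m x) n = m n * coord x n.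
Proof.
have nat_proper := @globally_properfilter nat setT 0%N I.
move=> /ex_bound[M bM]; rewrite /mult_op of_seqK//.
have hb k : `|m k * coord x k| <= `|coord (M *: x) k|.
  rewrite coordZ !normrM ler_wpM2r// (le_trans _ (ler_norm M))//.
  exact: bM.
by have [z zE _] := @coord_solid R E _ (fun k => m k * coord x k) hb; exists z.
Qed.

(* Every nonempty downward directed set with infimum 0 in [E] has norms with
   infimum 0, i.e. x_i decreasing to 0 implies norms decreasing to 0 for nets. *)
Definition order_continuous_norm : Prop :=
  forall A : set E, A !=set0 ->
    (forall x y, A x -> A y -> exists z, [/\ A z, pwle z x & pwle z y]) ->
    (forall x, A x -> pwle 0 x) ->
    (forall z, (forall x, A x -> pwle z x) -> pwle z 0) ->
    inf [set `|x| | x in A] = 0.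

Definition is_linfty : Prop :=
  range (@coord R E) = [set u | bounded_fun u] /\
  forall x, `|x| = sup (range (fun n => `|coord x n|)).

Section Representations.
Variable G : groupType.
Implicit Types rho theta pi : G -> E -> E.

Definition positive_rep rho : Prop :=
  (forall s, lattice_automorphism (rho s)) /\
  (forall s t, rho (s * t)%g = rho s \o rho t).

Definition permutation_rep pi : Prop :=
  positive_rep pi /\ forall s, permutation_operator (pi s).

(* [{ptws E -> E}], for the norm topology on the codomain, carries the strong
   operator topology; compactness of a set of operators does not depend on the
   ambient space of operators. *)
Definition compact_image rho : Prop :=
  compact (range rho : set {ptws E -> E}).

Definition conj_rep m pi : G -> E -> E :=
  fun s => mult_op m \o pi s \o mult_op (fun n => (m n)^-1).

Definition order_equivalent rho theta : Prop :=
  exists2 T, lattice_automorphism T & forall s, T \o rho s = theta s \o T.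

Definition isometrically_order_equivalent rho theta : Prop :=
  exists T, [/\ lattice_automorphism T, isometric T
              & forall s, T \o rho s = theta s \o T].

End Representations.

Definition strongly_continuous (G : topologicalGroupType) (rho : G -> E -> E)
    : Prop :=
  continuous (rho : G -> {ptws E -> E}).

End SequenceSpace.

(* Main.v *)
Require Import Defs.
From HB Require Import structures.
From mathcomp Require Import all_boot all_order all_algebra.
From mathcomp Require Import all_classical all_reals all_analysis.

(* A lattice automorphism maps atoms to atoms, hence is a weighted composition
   [(T x)_n = a_n x_(psi n)] with [a > 0] and [psi] bijective, in a unique way.
   If [rho] has compact image, its orbits are bounded and a gliding hump bounds
   the weights [a_s] of [rho_s] uniformly in [s].  They form a cocycle, and
   [m := sup_s a_s] is a bounded solution of [a_s = m / (m o psi_s)]: thus [rho]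
   is the conjugate by [m] of its permutation part, which is unique and is
   preserved by order equivalence.  Conjugation by [m] is a homeomorphism for the
   strong operator topology, so compactness and continuity transfer. *)

Set Implicit Arguments.
Unset Strict Implicit.
Unset Printing Implicit Defensive.

Import Order.TTheory GRing.Theory Num.Theory.
Import numFieldNormedType.Exports.

(** * The topology of pointwise convergence on operators *)

Section PointwiseTopology.
Local Open Scope classical_set_scope.

Lemma ptws_eval_continuous (U : topologicalType) (V : uniformType) (x : U) :
  continuous ((fun f => f x) : {ptws U -> V} -> V).
Proof.
move=> f; have [+ _] := @pointwise_cvgP U V (nbhs (f : {ptws U -> V})) f _.
by apply; exact: cvg_id.
Qed.

Lemma continuous_ptws (X U : topologicalType) (V : uniformType)
    (F : X -> {ptws U -> V}) :
  (forall x, continuous (fun t => F t x)) -> continuous F.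
Proof.
move=> Fx t; have [_] := @pointwise_cvgP U V (F @ nbhs t) (F t) _.
by apply=> x; exact: Fx.
Qed.

End PointwiseTopology.

(** * Coordinates, unit vectors and the pointwise order *)

Section SymmetricSeqSpace.
Local Open Scope classical_set_scope.
Local Open Scope ring_scope.
Variables (R : realType) (E : symmetricSeqSpaceType R).
Implicit Types (x y z : E) (T S : E -> E) (a m : nat -> R) (psi phi : nat -> nat).

(* [Defs.coord] is shadowed by the coordinates of [vector]. *)
Local Notation coord := (@Defs.coord R E).

Lemma coord0 n : coord (0 : E) n = 0.
Proof. by rewrite -(scale0r (0 : E)) coordZ mul0r. Qed.

Lemma coordB x y n : coord (x - y) n = coord x n - coord y n.
Proof. by rewrite coordD -scaleN1r coordZ mulN1r. Qed.

Lemma eq_coord x y : (forall n, coord x n = coord y n) -> x = y.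
Proof. by move=> xy; apply: coord_inj; apply/funext. Qed.

Definition unit_vec (k : nat) : E := of_seq E (fun n => (n == k)%:R).

Lemma coord_unit_vec k n : coord (unit_vec k) n = (n == k)%:R.
Proof. by rewrite of_seqK//; have [z zE _] := @coord_unit R E k; exists z. Qed.

Lemma norm_unit_vec k : `|unit_vec k| = 1.
Proof.
have [z zE <-] := @coord_unit R E k.
by congr `| _ |; apply: eq_coord => n; rewrite coord_unit_vec zE.
Qed.

(** The sequence [x_n e_n] is dominated by [x], and its norm is [|x_n|] because [e_n] has norm 1. *)
Lemma le_coord_norm x n : `|coord x n| <= `|x|.
Proof.
have [|z zE zx] := @coord_solid R E x (fun k => coord x n * (k == n)%:R).
  move=> k; case: eqVneq => [->|_]; first by rewrite mulr1.
  by rewrite mulr0 normr0.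
suff -> : `|coord x n| = `|z| by [].
rewrite -[LHS]mulr1 -(norm_unit_vec n) -normrZ; congr `| _ |.
by apply: eq_coord => k; rewrite coordZ coord_unit_vec zE.
Qed.

Lemma coord_continuous n : continuous (fun x => coord x n).
Proof.
move=> x; apply/cvgrPdist_lt => e e0; near=> y.
by rewrite -coordB (le_lt_trans (le_coord_norm _ _))//.
Unshelve. all: by end_near. Qed.

(** Expressing the order through [join] makes it visible to lattice automorphisms, which are defined
    by preserving [join]. *)
Lemma pwleP x y : pwle x y <-> join x y = y.
Proof.
split=> [xy|xy n]; last by rewrite -xy joinE le_max lexx.
by apply: eq_coord => n; rewrite joinE max_r.
Qed.

Lemma pwle0_unit_vec k : pwle (0 : E) (unit_vec k).
Proof. by move=> n; rewrite coord0 coord_unit_vec ler0n. Qed.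

(** * Lattice automorphisms and their action on atoms *)

Lemma linear_scale T (c : R) x : linear T -> T (c *: x) = c *: T x.
Proof.
move=> linT; have T0 : T 0 = 0.
  apply: (addrI (T 0)); have := linT 1 0 0.
  by rewrite !scale1r addr0 => <-; rewrite addr0.
by have := linT c x 0; rewrite T0 !addr0.
Qed.

Lemma linear_sub T x y : linear T -> T (x - y) = T x - T y.
Proof.
by move=> linT; have := linT (-1) y x; rewrite !scaleN1r 2![- _ + _]addrC.
Qed.

Lemma lattice_automorphism_inv T : lattice_automorphism T ->
  exists S, [/\ lattice_automorphism S, cancel T S & cancel S T].
Proof.
move=> [linT [S TK SK] TJ]; exists S; split => //; split.
- by move=> c x y; apply: (can_inj TK); rewrite linT !SK.
- by exists T.
- by move=> x y; apply: (can_inj TK); rewrite TJ !SK.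
Qed.

Lemma lattice_automorphism_pwle T x y : lattice_automorphism T ->
  pwle (T x) (T y) <-> pwle x y.
Proof.
move=> [_ /bij_inj Tinj TJ]; rewrite !pwleP -TJ.
by split=> [/Tinj|->].
Qed.

Lemma lattice_automorphism_ge0 T x : lattice_automorphism T ->
  pwle 0 (T x) <-> pwle 0 x.
Proof.
move=> Taut; have [linT _ _] := Taut.
rewrite -{1}[0 : E](scale0r (T 0)) -linear_scale// scale0r.
exact: lattice_automorphism_pwle.
Qed.

(** This reads a coordinate off the order alone, so that an order isomorphism can transport it. *)
Lemma pwle_scale_unit_vec (c : R) k x : pwle 0 x ->
  pwle (c *: unit_vec k) x <-> c <= coord x k.
Proof.
move=> x0; split=> [/(_ k)|cx n]; first by rewrite coordZ coord_unit_vec eqxx mulr1.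
rewrite coordZ coord_unit_vec; case: eqVneq => [->|_]; first by rewrite mulr1.
by rewrite mulr0; have := x0 n; rewrite coord0.
Qed.

(* Unit vectors span the atoms: [0 <= y <= e_k] forces [y = y_k e_k]. *)
Lemma lattice_automorphism_unit_vec T k : lattice_automorphism T ->
  exists j c, 0 < c /\ T (unit_vec k) = c *: unit_vec j.
Proof.
move=> Taut; have [S [Saut TK SK]] := lattice_automorphism_inv Taut.
set u := T (unit_vec k).
have u0 : pwle 0 u by apply/lattice_automorphism_ge0 => //; exact: pwle0_unit_vec.
(* If all coordinates of [u] vanished, [unit_vec k = S u] would be 0, against its norm 1. *)
have [j uj0] : exists j, coord u j != 0.
  apply: contrapT => /forallNP uE; have := norm_unit_vec k.
  have -> : unit_vec k = 0.
    rewrite -[LHS]TK -/u (_ : u = 0 *: u); last first.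
      by apply: eq_coord => n; rewrite scale0r coord0; apply/eqP/negPn/negP/uE.
    by rewrite linear_scale ?scale0r//; case: Saut.
  by rewrite normr0 => /eqP; rewrite eq_sym oner_eq0.
have uj : 0 < coord u j by rewrite lt_neqAle eq_sym uj0; have := u0 j; rewrite coord0.
exists j, (coord u j); split=> //.
(* [y] is the part of [u] at the coordinate [j]. From [0 <= S y <= e_k] it follows that [S y] is a
   multiple of [e_k], so [y] is a multiple of [u]; comparing the coordinates at [j] gives the factor
   1. *)
set y := _ *: _.
have y0 : pwle 0 y.
  by move=> n; rewrite coord0 coordZ coord_unit_vec mulr_ge0 ?ler0n ?ltW.
have Sy0 : pwle 0 (S y) by apply/lattice_automorphism_ge0.
have Syk : pwle (S y) (unit_vec k).
  rewrite -[unit_vec k]TK; apply/lattice_automorphism_pwle => //.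
  exact/pwle_scale_unit_vec.
have SyE : S y = coord (S y) k *: unit_vec k.
  apply: eq_coord => n; rewrite coordZ coord_unit_vec.
  case: eqVneq => [->|nk]; first by rewrite mulr1.
  apply/le_anti; have := Sy0 n; have := Syk n.
  by rewrite coord0 coord_unit_vec (negbTE nk) mulr0 => -> ->.
have yE : y = coord (S y) k *: u.
  by rewrite -linear_scale -?SyE ?SK//; case: Taut.
have : coord y j = coord u j by rewrite coordZ coord_unit_vec eqxx mulr1.
rewrite yE coordZ -[RHS]mul1r => /(mulIf uj0) ->.
by rewrite scale1r.
Qed.

(** * Weighted composition operators *)

Definition weighted_composition a psi T :=
  forall x n, coord (T x) n = a n * coord x (psi n).

Lemma pos_part_decomp x : exists y z, [/\ pwle 0 y, pwle 0 z & x = y - z].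
Proof.
exists (join x 0), (join x 0 - x); split=> [n|n|]; last by rewrite subKr.
- by rewrite joinE coord0 le_max lexx orbT.
- by rewrite coordB joinE coord0 subr_ge0 le_max lexx.
Qed.

(* [(T x)_n] is the largest [c] with [c e_n <= T x], i.e. [c T^-1 e_n <= x]. *)
Lemma lattice_automorphism_weighted T : lattice_automorphism T ->
  exists a psi, (forall n, 0 < a n) /\ weighted_composition a psi T.
Proof.
move=> Taut; have [S [Saut TK SK]] := lattice_automorphism_inv Taut.
have [linT _ _] := Taut; have [linS _ _] := Saut.
have /choice[p pP] : forall n, exists p : nat * R,
    0 < p.2 /\ S (unit_vec n) = p.2 *: unit_vec p.1.
  by move=> n; have [j [c ?]] := lattice_automorphism_unit_vec n Saut; exists (j, c).
exists (fun n => (p n).2^-1), (fun n => (p n).1); split.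
  by move=> n; rewrite invr_gt0; have [] := pP n.
suff Tge0 x n : pwle 0 x -> coord (T x) n = (p n).2^-1 * coord x (p n).1.
  move=> x n; have [y [z [y0 z0 ->]]] := pos_part_decomp x.
  by rewrite linear_sub// !coordB mulrBr !Tge0.
move=> x0; have [b0 SE] := pP n.
have TE (c : R) : (c <= coord (T x) n) = (c * (p n).2 <= coord x (p n).1).
  have Tx0 : pwle 0 (T x) by apply/lattice_automorphism_ge0.
  apply/idP/idP => [/(pwle_scale_unit_vec _ _ Tx0)|].
    move=> /(lattice_automorphism_pwle _ _ Saut).
    by rewrite TK linear_scale// SE scalerA => /(pwle_scale_unit_vec _ _ x0).
  move=> /(pwle_scale_unit_vec _ _ x0); rewrite -scalerA -SE -linear_scale//.
  rewrite -[X in pwle _ X]TK => /(lattice_automorphism_pwle _ _ Saut).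
  by move=> /(pwle_scale_unit_vec _ _ Tx0).
(* Each inequality is [TE] with one of the two sides taken for [c]. *)
apply/le_anti; rewrite mulrC ler_pdivlMr// -TE lexx/=.
by rewrite TE divfK// gt_eqF.
Qed.

(** Testing on the unit vector at [psi1 n], the coordinate [n] of the image is [a1 n > 0], which
    forces [psi2 n = psi1 n]; the weights then agree. *)
Lemma weighted_composition_uniq a1 a2 psi1 psi2 T :
  (forall n, 0 < a1 n) ->
  weighted_composition a1 psi1 T -> weighted_composition a2 psi2 T ->
  a1 = a2 /\ psi1 = psi2.
Proof.
move=> a10 T1 T2.
have psiE n : psi1 n = psi2 n.
  apply/eqP; have := T1 (unit_vec (psi1 n)) n; rewrite T2 !coord_unit_vec eqxx mulr1.
  rewrite eq_sym; case: eqP => // _; rewrite mulr0 => a1E.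
  by have := a10 n; rewrite -a1E ltxx.
split; last exact/funext.
apply/funext => n; have := T1 (unit_vec (psi1 n)) n.
by rewrite T2 psiE !coord_unit_vec eqxx !mulr1 => ->.
Qed.

Lemma weighted_composition_comp a b psi phi T S :
  weighted_composition a psi T -> weighted_composition b phi S ->
  weighted_composition (fun n => a n * b (psi n)) (phi \o psi) (T \o S).
Proof. by move=> TE SE x n; rewrite /= TE SE mulrA. Qed.

Lemma weighted_composition_id : weighted_composition (fun=> 1) id id.
Proof. by move=> x n; rewrite mul1r. Qed.

(** The inverse of [T] is a weighted composition too; by uniqueness applied to both composites,
    which are the identity, the two index maps are mutually inverse. *)
Lemma weighted_composition_bij T a psi : lattice_automorphism T ->
  weighted_composition a psi T -> bijective psi.
Proof.
move=> Taut; have [S [Saut TK SK]] := lattice_automorphism_inv Taut.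
move=> TE; have [b [phi [b0 SE]]] := lattice_automorphism_weighted Saut.
have TSE := weighted_composition_comp TE SE.
have STE := weighted_composition_comp SE TE.
rewrite (_ : T \o S = id) in TSE; last exact/funext.
rewrite (_ : S \o T = id) in STE; last exact/funext.
have [|_ /funeqP e1] := weighted_composition_uniq _ weighted_composition_id TSE => //.
have [|_ /funeqP e2] := weighted_composition_uniq _ weighted_composition_id STE => //.
by exists phi => n; [rewrite [RHS]e1|rewrite [RHS]e2].
Qed.

Lemma eq_weighted_composition a psi T S :
  weighted_composition a psi T -> weighted_composition a psi S -> T = S.
Proof. by move=> TE SE; apply/funext => x; apply: eq_coord => n; rewrite TE SE. Qed.

Lemma weighted_composition_lattice a psi T : bijective T ->
  (forall n, 0 < a n) -> weighted_composition a psi T -> lattice_automorphism T.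
Proof.
move=> Tbij a0 TE; split=> //.
  move=> c x y; apply: eq_coord => n.
  by rewrite coordD coordZ !TE coordD coordZ mulrDr mulrCA.
by move=> x y; apply: eq_coord => n; rewrite joinE !TE joinE maxr_pMr// ltW.
Qed.

(** * Permutation operators *)

Definition composition_op psi : E -> E := fun x => of_seq E (coord x \o psi).

Lemma coord_composition_op psi x n : bijective psi ->
  coord (composition_op psi x) n = coord x (psi n).
Proof.
by move=> psib; rewrite of_seqK//; have [z zE _] := coord_perm psi x psib; exists z.
Qed.

Lemma composition_op_weighted psi : bijective psi ->
  weighted_composition (fun=> 1) psi (composition_op psi).
Proof. by move=> psib x n; rewrite coord_composition_op// mul1r. Qed.

Lemma composition_op_isometric psi : bijective psi -> isometric (composition_op psi).
Proof.
move=> psib x; have [z zE <-] := coord_perm psi x psib; congr `| _ |.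
by apply: eq_coord => n; rewrite coord_composition_op// zE.
Qed.

Lemma composition_op_lattice psi : bijective psi ->
  lattice_automorphism (composition_op psi).
Proof.
move=> psib; have psiE := composition_op_weighted psib.
apply: (weighted_composition_lattice _ _ psiE); last by move=> _; exact: ltr01.
have [phi psiK phiK] := psib; have phib : bijective phi by exists psi.
by exists (composition_op phi) => x; apply: eq_coord => n;
  rewrite !coord_composition_op// ?psiK ?phiK.
Qed.

(** Permutation operators are the weighted compositions of weight 1; [psi] is the inverse of the
    permutation that defines [T]. *)
Lemma permutation_operatorP T :
  permutation_operator T <->
  exists2 psi, bijective psi & weighted_composition (fun=> 1) psi T.
Proof.
split=> [[phi [psi [phiK psiK TE]]]|[psi [phi psiK phiK] TE]].
  by exists psi; [exists phi|move=> x n; rewrite mul1r].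
by exists phi, psi; split=> // x n; rewrite TE mul1r.
Qed.

(** * A uniform bound on the weights *)

Lemma coord_sum n (u : E ^nat) k :
  coord (series u n) k = \sum_(0 <= i < n) coord (u i) k.
Proof.
apply: (big_morph (fun x => coord x k)) => [x y|]; first exact: coordD.
exact: coord0.
Qed.

(** The series of the [2^-k e_(j k)] converges absolutely. Its terms are nonnegative, so repeated
    values of [j] only increase the coordinates. *)
Lemma geometric_unit_vec_sum (j : nat -> nat) :
  exists x, forall k, 2^-1 ^+ k <= coord x (j k).
Proof.
pose u k : E := 2^-1 ^+ k *: unit_vec (j k).
have cvgu : cvgn (series u).
  apply: normed_cvg.
  have -> : [normed series u] = series (geometric 1 2^-1).
    apply/funext => n; apply: eq_bigr => k _ /=.
    by rewrite normrZ norm_unit_vec mulr1 mul1r ger0_norm// exprn_ge0// invr_ge0.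
  apply: is_cvg_geometric_series.
  by rewrite ger0_norm ?invr_ge0// invf_lt1// ltr1n.
exists (limn (series u)) => k.
have : coord (series u n) (j k) @[n --> \oo] --> coord (limn (series u)) (j k).
  exact: (cvg_comp (series u) _ cvgu (@coord_continuous (j k) _)).
move=> /cvgr_to_ge; apply.
(* From [k.+1] terms on, the partial sums contain the term of index [k]. *)
exists k.+1 => // n /= kn.
have u0 i : 0 <= coord (u i) (j k).
  by rewrite coordZ coord_unit_vec mulr_ge0 ?exprn_ge0 ?invr_ge0.
rewrite coord_sum big_mkord (bigD1 (Ordinal kn))//=.
by rewrite coordZ coord_unit_vec eqxx mulr1 lerDl sumr_ge0.
Qed.

(* Gliding hump: weights above [4^k] hitting the coordinates of a vector of size
   at least [2^-k] would make its orbit unbounded. *)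
Lemma weights_bounded (I : Type) (T : I -> E -> E) (a : I -> nat -> R)
    (psi : I -> nat -> nat) :
  (forall i, weighted_composition (a i) (psi i) (T i)) ->
  (forall i n, 0 < a i n) ->
  (forall x, exists M, forall i, `|T i x| <= M) ->
  exists M, forall i n, a i n <= M.
Proof.
move=> TE a0 Tbnd; apply: contrapT => /forallNP noM.
(* [p k] pairs an operator index with a coordinate at which the weight is at least [4^k]; [x] below
   has size at least [2^-k] at the coordinate that this weight multiplies. *)
have /choice[p pP] : forall k : nat, exists p : I * nat, 2 ^+ (k + k) <= a p.1 p.2.
  move=> k; apply: contrapT => /forallNP h; apply: (noM (2 ^+ (k + k))) => i n.
  by apply/ltW; rewrite ltNge; apply/negP => h'; apply: (h (i, n)).
have [x xP] := geometric_unit_vec_sum (fun k => psi (p k).1 (p k).2).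
have [M xM] := Tbnd x.
have leM k : 2 ^+ k <= M.
  apply: le_trans (xM (p k).1); apply: le_trans (le_coord_norm _ (p k).2).
  rewrite (le_trans _ (ler_norm _))// TE.
  have -> : 2 ^+ k = 2 ^+ (k + k) * 2^-1 ^+ k :> R.
    by rewrite exprD -mulrA -exprMn divff// expr1n mulr1.
  by apply: ler_pM => //; rewrite exprn_ge0// invr_ge0.
(* For [k = Num.bound M] one has [M < k < 2 ^ k]. *)
have := leM (Num.bound M); apply/negP; rewrite -ltNge.
have M0 : 0 <= M by exact: le_trans (leM 0).
rewrite (lt_trans (archi_boundP M0))// -natrX ltr_nat; exact: ltn_expl.
Qed.

(** * Multiplication operators and conjugation by them *)

Lemma linfty_ppP m : linfty_pp m <->
  exists2 d, 0 < d & exists M, forall n, d <= m n <= M.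
Proof.
have nat_proper := @globally_properfilter nat setT 0%N I.
split=> [[/ex_bound[M mM] [d d0 dm]]|[d d0 [M mM]]].
  exists d => //; exists M => n; rewrite dm/=.
  exact: le_trans (ler_norm _) (mM n I).
split; last by exists d => // n; have /andP[] := mM n.
apply/ex_bound; exists M => n _ /=; have /andP[dm ?] := mM n.
by rewrite ger0_norm// (le_trans _ dm)// ltW.
Qed.

Lemma linfty_pp_gt0 m n : linfty_pp m -> 0 < m n.
Proof. by move=> [_ [d d0 /(_ n)]]; exact: lt_le_trans. Qed.

Lemma linfty_ppV m : linfty_pp m -> linfty_pp (fun n => (m n)^-1).
Proof.
move=> mpp; apply/linfty_ppP; have /linfty_ppP[d d0 [M mM]] := mpp.
have M0 : 0 < M.
  by have /andP[dm mM0] := mM 0%N; exact: lt_le_trans (le_trans dm mM0).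
exists M^-1; first by rewrite invr_gt0.
exists d^-1 => n; have /andP[dm mMn] := mM n.
by rewrite !lef_pV2 ?posrE ?(linfty_pp_gt0 n mpp)// dm mMn.
Qed.

Lemma mult_op_weighted m : linfty_pp m ->
  weighted_composition m id (mult_op m : E -> E).
Proof. by move=> [mb _] x n; rewrite mult_opE. Qed.

Lemma mult_opK m : linfty_pp m ->
  cancel (mult_op m) (mult_op (fun n => (m n)^-1) : E -> E).
Proof.
move=> mpp x; apply: eq_coord => n.
rewrite (mult_op_weighted (linfty_ppV mpp)) (mult_op_weighted mpp).
by rewrite mulKf// gt_eqF// linfty_pp_gt0.
Qed.

Lemma mult_opVK m : linfty_pp m ->
  cancel (mult_op (fun n => (m n)^-1) : E -> E) (mult_op m).
Proof.
move=> mpp x; apply: eq_coord => n.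
rewrite (mult_op_weighted mpp) (mult_op_weighted (linfty_ppV mpp)).
by rewrite mulVKf// gt_eqF// linfty_pp_gt0.
Qed.

Lemma mult_op_lattice m : linfty_pp m ->
  lattice_automorphism (mult_op m : E -> E).
Proof.
move=> mpp; apply: (weighted_composition_lattice _ _ (mult_op_weighted mpp)).
  by exists (mult_op (fun n => (m n)^-1)); [exact: mult_opK|exact: mult_opVK].
by move=> n; exact: linfty_pp_gt0.
Qed.

Lemma mult_op_continuous m : linfty_pp m -> continuous (mult_op m : E -> E).
Proof.
move=> mpp; have /linfty_ppP[d d0 [M mM]] := mpp.
have M0 : 0 < M.
  by have /andP[dm mM0] := mM 0%N; exact: lt_le_trans (le_trans dm mM0).
have leM x : `|mult_op m x| <= M * `|x|.
  (* Solidity, applied with [M *: x] as the dominating vector, bounds the operator norm by [M]. *)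
  have [|z zE] := @coord_solid R E (M *: x) (fun n => m n * coord x n).
    move=> n; rewrite coordZ !normrM ler_wpM2r//.
    have /andP[_ mMn] := mM n.
    by rewrite !gtr0_norm// linfty_pp_gt0.
  rewrite normrZ gtr0_norm//; apply: le_trans.
  suff -> : mult_op m x = z by [].
  by apply: eq_coord => n; rewrite mult_op_weighted// zE.
move=> x; apply/cvgrPdist_lt => e e0.
have eM0 : 0 < e / M by rewrite divr_gt0.
near=> y; have [linm _ _] := mult_op_lattice mpp.
by rewrite -linear_sub// (le_lt_trans (leM _))// mulrC -ltr_pdivlMr.
Unshelve. all: by end_near. Qed.

(** At a fixed [x], the map is evaluation at the fixed vector [m^-1 x] followed by the continuous
    operator [mult_op m]. *)
Lemma conj_mult_op_continuous m : linfty_pp m ->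
  continuous ((fun T => mult_op m \o T \o mult_op (fun n => (m n)^-1))
    : {ptws E -> E} -> {ptws E -> E}).
Proof.
move=> mpp; apply: continuous_ptws => x T.
set y := mult_op (fun n => (m n)^-1) x.
exact: (cvg_comp (fun S : {ptws E -> E} => S y) _ (@ptws_eval_continuous _ _ y T)
  (@mult_op_continuous m mpp (T y))).
Qed.

Lemma lattice_automorphism_comp T S :
  lattice_automorphism T -> lattice_automorphism S ->
  lattice_automorphism (T \o S).
Proof.
move=> [linT Tb TJ] [linS Sb SJ]; split; last by move=> x y /=; rewrite SJ TJ.
- by move=> c x y /=; rewrite linS linT.
- exact: bij_comp.
Qed.

(** * Positive representations and their permutation parts *)

Section Representations.
Variable G : groupType.
Implicit Types rho pi : G -> E -> E.

Lemma conj_repK m : linfty_pp m ->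
  cancel (@conj_rep R E G m) (conj_rep (fun n => (m n)^-1)).
Proof.
move=> mpp rho; apply/funext => s; apply/funext => x; rewrite /conj_rep /=.
rewrite (_ : (fun n => ((m n)^-1)^-1) = m); last by apply/funext => n; rewrite invrK.
by rewrite !mult_opK.
Qed.

Lemma conj_rep_positive m rho : linfty_pp m -> positive_rep rho ->
  positive_rep (conj_rep m rho).
Proof.
move=> mpp [rho_aut rhoM]; split=> [s|s t].
  apply: lattice_automorphism_comp; last exact/mult_op_lattice/linfty_ppV.
  by apply: lattice_automorphism_comp => //; exact: mult_op_lattice.
by apply/funext => x; rewrite /conj_rep /= rhoM /= mult_opK.
Qed.

Lemma conj_rep_compact m rho : linfty_pp m -> compact_image rho ->
  compact_image (conj_rep m rho).
Proof.
move=> mpp rhoc; rewrite /compact_image.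
pose Phi : {ptws E -> E} -> {ptws E -> E} :=
  fun T => mult_op m \o T \o mult_op (fun n => (m n)^-1).
have -> : range (conj_rep m rho) = Phi @` range rho.
  by rewrite image_comp.
apply: continuous_compact rhoc.
by apply: continuous_subspaceT; exact: conj_mult_op_continuous.
Qed.

(** An orbit is the image of [range rho] under a continuous evaluation, hence compact. *)
Lemma compact_image_bounded rho x : compact_image rho ->
  exists M, forall s, `|rho s x| <= M.
Proof.
move=> rhoc.
have : compact ((fun T : {ptws E -> E} => T x) @` range rho).
  apply: continuous_compact rhoc; apply: continuous_subspaceT.
  exact: ptws_eval_continuous.
move=> /compact_bounded; rewrite /bounded_set/= /bounded_near.
move=> /pinfty_ex_gt0[M _ xM]; exists M => s; apply: xM.
by exists (rho s) => //; exists s.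
Qed.

Lemma conj_rep_weighted m pi psi s : linfty_pp m ->
  weighted_composition (fun=> 1) psi (pi s) ->
  weighted_composition (fun n => m n / m (psi n)) psi (conj_rep m pi s).
Proof.
move=> mpp piE x n; rewrite /conj_rep /= (mult_op_weighted mpp) piE mul1r.
by rewrite (mult_op_weighted (linfty_ppV mpp)) mulrA.
Qed.

(** Conjugation by a multiplication operator changes the weights but not the index maps, and these
    determine a permutation representation. *)
Lemma conj_rep_inj m1 m2 pi1 pi2 : linfty_pp m1 -> linfty_pp m2 ->
  permutation_rep pi1 -> permutation_rep pi2 ->
  conj_rep m1 pi1 = conj_rep m2 pi2 -> pi1 = pi2.
Proof.
move=> m1pp m2pp [_ pi1P] [_ pi2P] eq12; apply/funext => s.
have /permutation_operatorP[psi1 _ pi1E] := pi1P s.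
have /permutation_operatorP[psi2 _ pi2E] := pi2P s.
have rho1E := conj_rep_weighted m1pp pi1E.
have := conj_rep_weighted m2pp pi2E; rewrite -eq12 => rho2E.
have [|_ psiE] := weighted_composition_uniq _ rho1E rho2E.
  by move=> n; rewrite divr_gt0// linfty_pp_gt0.
by rewrite psiE in pi1E; exact: eq_weighted_composition pi1E pi2E.
Qed.

(** The operator [rho 1] is an injective idempotent. *)
Lemma positive_rep1 rho : positive_rep rho -> rho 1%g = id.
Proof.
move=> [rho_aut rhoM]; have [_ /bij_inj rho1_inj _] := rho_aut 1%g.
apply/funext => x; apply: rho1_inj.
by rewrite -[LHS]/((rho 1%g \o rho 1%g) x) -rhoM mulg1.
Qed.

(* The weights [a_s] of [rho_s] form a cocycle, [a_(st) = a_s (a_t o psi_s)],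
   so [m := sup_s a_s] satisfies [m = a_s (m o psi_s)]. *)
Lemma positive_rep_conj rho : positive_rep rho ->
  (forall x, exists M, forall s, `|rho s x| <= M) ->
  exists pi m, [/\ permutation_rep pi, linfty_pp m & rho = conj_rep m pi].
Proof.
move=> rho_pos rho_bnd; have [rho_aut rhoM] := rho_pos.
have /choice[p pP] : forall s, exists p : (nat -> R) * (nat -> nat),
    (forall n, 0 < p.1 n) /\ weighted_composition p.1 p.2 (rho s).
  by move=> s; have [a [psi ?]] := lattice_automorphism_weighted (rho_aut s);
    exists (a, psi).
pose a s := (p s).1; pose psi s := (p s).2.
have a0 s n : 0 < a s n by have [+ _] := pP s; exact.
have rhoE s : weighted_composition (a s) (psi s) (rho s) by have [] := pP s.
have psib s : bijective (psi s).
  exact: weighted_composition_bij (rho_aut s) (rhoE s).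
(* Uniqueness of weights and index maps turns multiplicativity into two identities. The index maps
   compose in reverse order, being inverses of the permutations. *)
have cocycle s t :
    a (s * t)%g = (fun n => a s n * a t (psi s n)) /\
    psi (s * t)%g = psi t \o psi s.
  apply: weighted_composition_uniq (a0 _) (rhoE _) _.
  by rewrite rhoM; exact: weighted_composition_comp.
have aM s t n : a (s * t)%g n = a s n * a t (psi s n).
  by have [-> _] := cocycle s t.
have a1 n : a 1%g n = 1.
  have := rhoE 1%g; rewrite (positive_rep1 rho_pos) => idE.
  by have [-> _] := weighted_composition_uniq (a0 1%g) idE
    (weighted_composition_id).
have [M aleM] := weights_bounded rhoE a0 rho_bnd.
pose m n := sup (range (fun s => a s n)).
have a_le_m s n : a s n <= m n.
  by apply: ub_le_sup; [exists M => _ [t _ <-]|exists s].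
have m_le n c : (forall s, a s n <= c) -> m n <= c.
  by move=> ac; apply: ge_sup => [|_ [s _ <-]//]; exists (a 1%g n), 1%g.
(* The lower bound 1 is the weight of the group unit. *)
have mpp : linfty_pp m.
  apply/linfty_ppP; exists 1 => //; exists M => n.
  by rewrite -(a1 n) a_le_m m_le.
(* For one inequality write [t] as [s (s^-1 t)]; for the other, bound the weight of each product
   [s t] by [m n]. *)
have mE s n : m n = a s n * m (psi s n).
  apply/le_anti/andP; split.
    apply: m_le => t; rewrite -[t](mulVKg s) aM.
    by rewrite ler_wpM2l ?a_le_m// ltW.
  rewrite mulrC -ler_pdivlMr//; apply: m_le => t.
  by rewrite ler_pdivlMr// mulrC -aM.
have piE s := composition_op_weighted (psib s).
exists (fun s => composition_op (psi s)), m; split=> //.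
  split=> [|s]; last by apply/permutation_operatorP; exists (psi s).
  split=> [s|s t]; first exact: composition_op_lattice.
  apply: eq_weighted_composition (piE _) _; have [_ ->] := cocycle s t.
  have := weighted_composition_comp (piE s) (piE t).
  by under eq_fun do rewrite mulr1.
apply/funext => s; apply: eq_weighted_composition (rhoE s) _.
have -> : a s = (fun n => m n / m (psi s n)).
  by apply/funext => n; rewrite (mE s n) mulfK// gt_eqF// linfty_pp_gt0.
exact: (conj_rep_weighted (pi := fun s => composition_op (psi s))).
Qed.

(** Comparing the index maps on both sides of the intertwining relation shows that the permutation
    part of [T] intertwines [pi1] and [pi2]. Conversely, an intertwiner [U] gives [m2 U m1^-1]. *)
Lemma order_equivalent_conj_rep m1 m2 pi1 pi2 :
  linfty_pp m1 -> linfty_pp m2 -> permutation_rep pi1 -> permutation_rep pi2 ->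
  order_equivalent (conj_rep m1 pi1) (conj_rep m2 pi2) <->
  isometrically_order_equivalent pi1 pi2.
Proof.
move=> m1pp m2pp [_ pi1P] [_ pi2P]; split=> [[T Taut TE]|[U [Uaut _ UE]]].
  have [a [tau [a0 TaE]]] := lattice_automorphism_weighted Taut.
  have taub := weighted_composition_bij Taut TaE.
  exists (composition_op tau); split.
  - exact: composition_op_lattice.
  - exact: composition_op_isometric.
  move=> s.
  have /permutation_operatorP[psi1 _ pi1E] := pi1P s.
  have /permutation_operatorP[psi2 _ pi2E] := pi2P s.
  have := weighted_composition_comp (conj_rep_weighted m2pp pi2E) TaE.
  rewrite -TE => T2E.
  have T1E := weighted_composition_comp TaE (conj_rep_weighted m1pp pi1E).
  have [|_ psiE] := weighted_composition_uniq _ T1E T2E.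
    by move=> n; rewrite mulr_gt0// divr_gt0// linfty_pp_gt0.
  have tauE := composition_op_weighted taub.
  have U1E := weighted_composition_comp tauE pi1E.
  have U2E := weighted_composition_comp pi2E tauE.
  by rewrite psiE in U1E; exact: eq_weighted_composition U1E U2E.
exists (mult_op m2 \o U \o mult_op (fun n => (m1 n)^-1)).
  apply: lattice_automorphism_comp; last exact/mult_op_lattice/linfty_ppV.
  by apply: lattice_automorphism_comp => //; exact: mult_op_lattice.
move=> s; apply/funext => x; rewrite /conj_rep /= !mult_opK//.
by rewrite -[in LHS]/((U \o pi1 s) _) UE.
Qed.

End Representations.

Lemma conj_rep_strongly_continuous (G : topologicalGroupType) m
    (rho : G -> E -> E) : linfty_pp m -> strongly_continuous rho ->
  strongly_continuous (conj_rep m rho).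
Proof.
move=> mpp rhoc s.
exact: (cvg_comp _ _ (rhoc s) (@conj_mult_op_continuous m mpp (rho s))).
Qed.

End SymmetricSeqSpace.

Theorem theorem5p4 (R : realType) (E : symmetricSeqSpaceType R)
    (hE : order_continuous_norm E \/ is_linfty E) :
  (forall G : groupType,
    [/\ forall rho : G -> E -> E, positive_rep rho -> compact_image rho ->
          (exists! pi : G -> E -> E, permutation_rep pi /\
             exists2 m : nat -> R, linfty_pp m & rho = conj_rep m pi) /\
          (forall (pi : G -> E -> E) (m : nat -> R),
             permutation_rep pi -> linfty_pp m -> rho = conj_rep m pi ->
             compact_image pi),
        forall (pi : G -> E -> E) (m : nat -> R),
          permutation_rep pi -> compact_image pi -> linfty_pp m ->
          positive_rep (conj_rep m pi) /\ compact_image (conj_rep m pi)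
      & forall (rho1 rho2 pi1 pi2 : G -> E -> E) (m1 m2 : nat -> R),
          positive_rep rho1 -> compact_image rho1 ->
          positive_rep rho2 -> compact_image rho2 ->
          permutation_rep pi1 -> compact_image pi1 ->
          permutation_rep pi2 -> compact_image pi2 ->
          linfty_pp m1 -> linfty_pp m2 ->
          rho1 = conj_rep m1 pi1 -> rho2 = conj_rep m2 pi2 ->
          (order_equivalent rho1 rho2 <->
           isometrically_order_equivalent pi1 pi2)]) /\
  (forall (G : topologicalGroupType) (rho pi : G -> E -> E) (m : nat -> R),
     positive_rep rho -> compact_image rho ->
     permutation_rep pi -> compact_image pi -> linfty_pp m ->
     rho = conj_rep m pi ->
     (strongly_continuous rho <-> strongly_continuous pi)).
Proof.
split=> [G|G rho pi m _ _ _ _ mpp ->]; last first.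
  split; last exact: conj_rep_strongly_continuous.
  move=> /(conj_rep_strongly_continuous (linfty_ppV mpp)).
  by rewrite conj_repK.
split=> [rho rho_pos rhoc|pi m [pi_pos _] pic mpp|].
- split=> [|pi m _ mpp rhoE]; last first.
    (* [pi] is recovered from [rho] by conjugating with [m^-1]. *)
    by rewrite -(conj_repK mpp pi) -rhoE; apply/conj_rep_compact/rhoc/linfty_ppV.
  have [x|pi [m [pi_perm mpp rhoE]]] := positive_rep_conj rho_pos.
    exact: compact_image_bounded.
  exists pi; split=> [|pi' [pi'_perm [m' m'pp rhoE']]]; first by split=> //; exists m.
  (* Only [pi] is claimed to be unique: the multipliers [m] and [m'] may differ. *)
  by apply: (conj_rep_inj mpp m'pp); rewrite // -rhoE.
- by split; [exact: conj_rep_positive|exact: conj_rep_compact].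
move=> rho1 rho2 pi1 pi2 m1 m2 _ _ _ _ pi1P _ pi2P _ m1pp m2pp -> ->.
exact: order_equivalent_conj_rep.
Qed.
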